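(* Let $D$ be a digraph of order $n$. Then $\lambda(D)=n-1$ if and only if $D$ is a Hessenberg path $(v_1,v_2,\ldots,v_n)$ such that $v_1$ is a source.
   Context: Digraphs are finite, without loops or multiple arcs, though between a pair of vertices there may be an arc in each direction; the order is $n=|V(D)|\ge 1$. $N^-(v)$ is the set of vertices from which there is an arc to $v$. A source is a vertex $v$ with $N^-(v)=\varnothing$. Zero forcing on digraphs: a subset $S\subseteq V(D)$ is colored blue and all other vertices white. Digraph color change rule: if a blue vertex has exactly one white out-neighbor, then that white out-neighbor becomes blue. $S$ is a zero forcing set if repeated application of the rule eventually turns all vertices blue. The zero forcing span $\lambda(D)$ is the number of distinct cardinalities $k$ for which there exist $Z,F\subseteq V(D)$ with $|Z|=|F|=k$ such that $Z$ is a zero forcing set and $F$ is not a zero forcing set. A (directed) path $(v_1,v_2,\ldots,v_k)$ in $D$ (so each $(v_i,v_{i+1})$ is an arc) is Hessenberg if $E(D)$ does not contain any arc of the form $(v_i,v_j)$ with $j>i+1$ (arcs $(v_i,v_j)$ with $j<i$ are allowed). ''$D$ is a Hessenberg path $(v_1,\ldots,v_n)$'' means that $V(D)=\{v_1,\ldots,v_n\}$ and $(v_1,\ldots,v_n)$ is a Hessenberg path in $D$. *)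

(* Defs.v *)
From mathcomp Require Import all_boot.

Set Implicit Arguments.
Unset Strict Implicit.
Unset Printing Implicit Defensive.

(* A digraph is a finite vertex type T with an irreflexive arc relation
   e : rel T, where [e u v] means that there is an arc from u to v. *)

Definition in_neighbors (T : finType) (e : rel T) (v : T) : {set T} :=
  [set u | e u v].

Definition source (T : finType) (e : rel T) (v : T) : Prop :=
  in_neighbors e v = set0.

Definition white_out (T : finType) (e : rel T) (B : {set T}) (u : T) : {set T} :=
  [set w | e u w & w \notin B].

(* One application of the color change rule, from blue set B to blue set B'. *)
Definition color_change (T : finType) (e : rel T) : rel {set T} :=
  fun B B' => [exists u in B, exists w,
    (white_out e B u == [set w]) && (B' == w |: B)].

Definition zero_forcing (T : finType) (e : rel T) (S : {set T}) : bool :=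
  connect (color_change e) S [set: T].

(* Subsets of T have cardinality at most #|T|, so k ranges over 'I_(#|T|.+1). *)
Definition zf_span (T : finType) (e : rel T) : nat :=
  #|[set k : 'I_(#|T|.+1) | [exists Z : {set T}, exists F : {set T},
       [&& #|Z| == k, #|F| == k, zero_forcing e Z & ~~ zero_forcing e F]]]|.

(* The path is x :: p, so x is its first vertex; a path has distinct vertices. *)
Definition hessenberg_path (T : finType) (e : rel T) (x : T) (p : seq T) : Prop :=
  [/\ path e x p, uniq (x :: p)
    & forall i j : nat, i.+1 < j -> j < size (x :: p) ->
        ~~ e (nth x (x :: p) i) (nth x (x :: p) j)].

Definition is_hessenberg_path (T : finType) (e : rel T) (x : T) (p : seq T) :
    Prop :=
  hessenberg_path e x p /\ (forall v : T, v \in x :: p).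

(* Main.v *)
Require Import Defs.
From mathcomp Require Import all_boot.

(** Only the cardinalities [0 < k < n] can contribute to the span, so it equals
    [n - 1] exactly when all of them do.  For [k = 1] this yields a zero forcing
    singleton; once a vertex has forced, all its out-neighbours are blue, so only
    the most recently coloured vertex can force next and the forcing chain is a
    Hessenberg path.  For [k = n - 1] it yields a vertex that is not forced by all
    the others, i.e. a source, which can only be the first vertex of the path.
    Conversely, every nonempty prefix of a Hessenberg path is zero forcing, and no
    set avoiding a source is. *)

Section ZeroForcing.

Set Implicit Arguments.
Unset Strict Implicit.

Variables (T : finType) (e : rel T).
Implicit Types (S F B : {set T}) (x v w : T) (p : seq T).

Definition span_size (k : nat) : Prop :=
  exists Z F : {set T},
    [/\ #|Z| = k, #|F| = k, zero_forcing e Z & ~~ zero_forcing e F].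

Lemma color_change_neq0 B B' : color_change e B B' -> B != set0.
Proof.
by case/existsP=> u /andP[uB _]; apply/set0Pn; exists u.
Qed.

Lemma zero_forcing_set0 : 0 < #|T| -> ~~ zero_forcing e set0.
Proof.
move=> T_gt0; apply/connectP=> -[[|B q] /=].
  by move=> _ T0; rewrite -cardsT T0 cards0 in T_gt0.
by move=> /andP[/color_change_neq0]; rewrite eqxx.
Qed.

Lemma zero_forcing_setT : zero_forcing e [set: T].
Proof. exact: connect0. Qed.

(** The only sets of size 0 and #|T| are the empty set and the whole vertex set, and for each of
    these the outcome is fixed. *)
Lemma span_size_bounds k : 0 < #|T| -> span_size k -> 0 < k < #|T|.
Proof.
move=> T_gt0 [Z [F [Zk Fk Zzf Fnzf]]]; apply/andP; split.
  rewrite lt0n -Zk cards_eq0; apply: contraTneq Zzf => ->.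
  exact: zero_forcing_set0.
rewrite -Fk ltn_neqAle max_card andbT; apply: contraNneq Fnzf => FT.
suff -> : F = setT by exact: zero_forcing_setT.
by apply/eqP; rewrite eqEcard subsetT cardsT FT /=.
Qed.

Lemma zf_span_eq : 0 < #|T| ->
  zf_span e = #|T| - 1 <-> (forall k, 0 < k < #|T| -> span_size k).
Proof.
move=> T_gt0; rewrite /zf_span.
set A := [set k | _]; pose I := [set k : 'I_(#|T|.+1) | 0 < k < #|T|].
have AP (k : 'I_(#|T|.+1)) : reflect (span_size k) (k \in A).
  rewrite inE; apply: (iffP existsP).
    by case=> Z /existsP[F /and4P[/eqP ? /eqP ? ? ?]]; exists Z, F.
  case=> Z [F [Zk Fk Zzf Fnzf]]; exists Z; apply/existsP; exists F.
  by rewrite Zk Fk Zzf Fnzf !eqxx.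
have AI : A \subset I.
  by apply/subsetP=> k /AP /(span_size_bounds T_gt0); rewrite inE.
have cardI : #|I| = #|T| - 1.
  (* The two removed ordinals differ since [T] is nonempty, which leaves #|T| + 1 - 2 sizes. *)
  have -> : I = ~: [set ord0; ord_max].
    apply/setP=> k; rewrite !inE negb_or -!val_eqE /= lt0n; congr (_ && _).
    by rewrite ltn_neqAle -[k <= _]ltnS ltn_ord andbT.
  rewrite cardsCs setCK card_ord cards2 -val_eqE /= eq_sym -lt0n T_gt0.
  by rewrite subSS.
split=> [cardA k /andP[k_gt0 kT] | spanT].
  have AE : A = I by apply/eqP; rewrite eqEcard AI cardI cardA /=.
  have kA : Ordinal (ltnW kT : k < #|T|.+1) \in A by rewrite AE inE k_gt0.
  by have /AP := kA.
rewrite -cardI; congr #|pred_of_set _|; apply/eqP; rewrite eqEsubset AI /=.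
by apply/subsetP=> k kI; apply/AP/spanT; rewrite inE in kI.
Qed.

(** Invariant of the forcing process started at [x]: [p] lists the forced vertices in order, and
    only the last vertex of [x :: p] may still have white out-neighbours. *)
Definition forcing_chain B x p : Prop :=
  [/\ hessenberg_path e x p, B = [set:: x :: p]
    & forall i, i < size p -> white_out e B (nth x (x :: p) i) = set0].

Lemma forcing_chain_step B B' x p :
  forcing_chain B x p -> color_change e B B' ->
  exists w, forcing_chain B' x (rcons p w).
Proof.
case=> -[xp Uxp Hxp] BE wo0 /existsP[u /andP[uB /existsP[w]]].
case/andP=> /eqP wo_u /eqP ->; exists w.
have /andP[euw wB] : e u w && (w \notin B).
  by have := set11 w; rewrite -wo_u inE.
have uE : u = last x p.
  (* An earlier vertex of the chain has no white out-neighbour, so it could not force [w]. *)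
  move: uB; rewrite BE in_set => /(nthP x)[i]; rewrite /= ltnS leq_eqVlt.
  case/predU1P=> [-> <-|ip iu]; first by rewrite (last_nth x).
  by have := wo0 i ip; rewrite iu wo_u => /setP/(_ w); rewrite set11 inE.
have nth_old i : i <= size p ->
    nth x (x :: rcons p w) i = nth x (x :: p) i.
  by move=> ip; rewrite -rcons_cons nth_rcons /= ltnS ip.
have white_outS v : white_out e (w |: B) v = white_out e B v :\ w.
  by apply/setP=> z; rewrite !inE negb_or; case: (z == w); rewrite ?andbF.
split; last first.
- move=> i; rewrite size_rcons ltnS => ip; rewrite nth_old // white_outS.
  move: ip; rewrite leq_eqVlt => /predU1P[->|ip]; last by rewrite wo0 // set0D.
  by rewrite -last_nth -uE wo_u setDv.
- by apply/setP=> z; rewrite BE !inE mem_rcons inE orbCA.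
split; first by rewrite rcons_path xp -uE.
  by rewrite -rcons_cons rcons_uniq Uxp andbT; move: wB; rewrite BE in_set.
(* Only arcs into the new end [w] need an argument: [w] was white, so no vertex before the last has
   an arc to it. *)
move=> i j ij; rewrite /= size_rcons ltnS leq_eqVlt => /predU1P[jE|jp].
  have ip : i < size p by rewrite jE ltnS in ij.
  rewrite nth_old 1?ltnW // jE /= nth_rcons ltnn eqxx.
  apply/negP=> eiw; have := in_set0 w.
  by rewrite -(wo0 i ip) inE eiw wB.
have jp' : j <= size p by [].
by rewrite !nth_old //; [exact: Hxp | exact: leq_trans (ltnW (ltnW ij)) _].
Qed.

Lemma zero_forcing1_hessenberg x :
  zero_forcing e [set x] -> exists p, is_hessenberg_path e x p.
Proof.
case/connectP=> q.
have: exists p, forcing_chain [set x] x p.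
  exists [::]; split=> //; last by apply/setP=> z; rewrite !inE.
  by split=> // i [|j].
elim: q [set x] => [|B' q IHq] B [p Bp] /=.
  case: Bp => xp -> _ _ BT; exists p; split=> // v.
  by have := in_setT v; rewrite BT in_set.
by case/andP=> /(forcing_chain_step Bp)[w B'w]; apply: IHq; exists (rcons p w).
Qed.

Lemma is_hessenberg_path_size x p :
  is_hessenberg_path e x p -> size (x :: p) = #|T|.
Proof.
case=> -[_ Uxp _] inxp; rewrite -(card_uniqP Uxp).
by apply: eq_card => v; rewrite inxp.
Qed.

Lemma zero_forcing_prefix x p k : is_hessenberg_path e x p ->
  0 < k -> zero_forcing e [set:: take k (x :: p)].
Proof.
move=> hp; have [[xp Uxp Hxp] inxp] := hp.
have full m : size (x :: p) <= m -> [set:: take m (x :: p)] = setT.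
  by move=> pm; apply/setP=> v; rewrite in_set take_oversize // inxp in_setT.
(* Induction on a bound [d] for the number of vertices outside the prefix. *)
move: {2}(_ - k) (leqnn (size (x :: p) - k)) => d.
elim: d k => [|d IHd] k pkd k_gt0.
  rewrite full; last by rewrite -subn_eq0 -leqn0.
  exact: zero_forcing_setT.
have [pk|kp] := leqP (size (x :: p)) k.
  by rewrite full //; exact: zero_forcing_setT.
apply: (connect_trans _ (IHd k.+1 _ isT)); last first.
  by rewrite subnS -subn1 leq_subLR add1n.
set s := x :: p in pkd kp Uxp Hxp inxp *.
have kp' : k.-1 < size s by rewrite prednK // ltnW.
have in_take v : (v \in take k s) = (index v s < k).
  by rewrite in_take ?inxp.
(* The last vertex of the prefix forces its successor on the path: an arc from it to a vertex
   further on would violate the Hessenberg condition. *)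
apply/connect1/existsP; exists (nth x s k.-1).
rewrite in_set in_take index_uniq // prednK // leqnn andTb.
apply/existsP; exists (nth x s k); apply/andP; split; apply/eqP/setP=> v; last first.
  by rewrite (take_nth x) // !inE mem_rcons inE.
rewrite !inE in_take -leqNgt; apply/andP/eqP=> [[ev kv] | ->].
  have vs : index v s < size s by rewrite index_mem inxp.
  move: kv; rewrite leq_eqVlt => /predU1P[->|kv]; first by rewrite nth_index ?inxp.
  by have := Hxp k.-1 (index v s); rewrite prednK // nth_index ?inxp // ev => /(_ kv vs).
split; last by rewrite index_uniq.
have -> : nth x s k = nth x p k.-1 by rewrite -{1}(prednK k_gt0).
by move/pathP: xp => /(_ x); apply; rewrite -ltnS prednK.
Qed.

(** A forced vertex has an in-neighbour, so a source that starts white stays white. *)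
Lemma source_zero_forcing v S : source e v -> zero_forcing e S -> v \in S.
Proof.
move=> sv; apply: contraTT => vS; apply/connectP=> -[q].
elim: q S vS => [|B q IHq] S vS /=; first by move=> _ ST; rewrite -ST inE in vS.
case/andP=> /existsP[u /andP[_ /existsP[w /andP[/eqP wo_u /eqP BE]]]].
apply: IHq; rewrite BE !inE negb_or vS andbT; apply/eqP=> vw.
have := set11 w; rewrite -wo_u -vw inE => /andP[euv _].
by have := in_set0 u; rewrite -sv inE euv.
Qed.

(** An in-neighbour of [w] would differ from [w], hence be blue, and would force [w], the only white
    vertex, in one step. *)
Lemma not_zero_forcing_setC1 w :
  irreflexive e -> ~~ zero_forcing e (~: [set w]) -> source e w.
Proof.
move=> irr; apply: contraNeq => /set0Pn[u]; rewrite inE => euw.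
apply/connect1/existsP; exists u; rewrite !inE; apply/andP; split.
  by apply: contraTneq euw => ->; rewrite irr.
apply/existsP; exists w; rewrite setUCr eqxx andbT.
by apply/eqP/setP=> z; rewrite !inE negbK; case: eqP => [->|_]; rewrite ?euw ?andbF.
Qed.

End ZeroForcing.

Theorem theorem19 (n : nat) (T : finType) (e : rel T)
    (e_loopless : irreflexive e) (n_gt0 : 0 < n) (T_order : #|T| = n) :
  zf_span e = n - 1 <->
  exists (v1 : T) (p : seq T), is_hessenberg_path e v1 p /\ source e v1.
Proof.
subst n; apply: iff_trans (zf_span_eq e n_gt0) _.
split=> [spanT | [x [p [hp sx]]] k /andP[k_gt0 kT]].
  have [x zfx] : exists x, zero_forcing e [set x].
    (* With a single vertex [spanT] is vacuous, so this case is treated directly, here and for [w]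
       below. *)
    have := n_gt0; rewrite leq_eqVlt => /predU1P[/esym/eqP T1 | T_gt1].
      rewrite -cardsT in T1; case/cards1P: T1 => x xT; exists x.
      by rewrite -xT zero_forcing_setT.
    have [Z [_ [/eqP/cards1P[x ->] _ zfx _]]] := spanT 1 T_gt1.
    by exists x.
  have [w nzfw] : exists w, ~~ zero_forcing e (~: [set w]).
    have := n_gt0; rewrite leq_eqVlt => /predU1P[/esym T1 | T_gt1].
      exists x; suff -> : ~: [set x] = set0 by apply: zero_forcing_set0.
      by apply/eqP; rewrite -cards_eq0 cardsCs setCK cards1 T1.
    have [|_ [F [_ Fk _ nzfF]]] := spanT #|T|.-1.
      by rewrite -ltnS prednK // T_gt1 leqnn.
    have /eqP/cards1P[w Fw] : #|~: F| = 1.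
      by rewrite cardsCs setCK Fk -subn1 subKn.
    by exists w; rewrite -Fw setCK.
  have sw := not_zero_forcing_setC1 e_loopless nzfw.
  have := source_zero_forcing sw zfx; rewrite inE => /eqP wx.
  have [p hp] := zero_forcing1_hessenberg zfx.
  by exists x, p; split; rewrite // -wx.
have [[_ Uxp _] _] := hp; have /andP[xp Up] := Uxp.
have size_xp := is_hessenberg_path_size hp.
have card_prefix s : uniq s -> k <= size s -> #|[set:: take k s]| = k.
  by move=> Us ks; rewrite cardsE (card_uniqP (take_uniq _ Us)) size_takel.
(* Both sets are runs of [k] consecutive path vertices; the second starts just after the source [x]
   and fits because [p] has #|T| - 1 vertices. *)
exists [set:: take k (x :: p)], [set:: take k p]; split.
- by rewrite card_prefix // size_xp ltnW.
- by rewrite -size_xp in kT; rewrite card_prefix.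
- exact: zero_forcing_prefix.
apply: contraNN xp => /(source_zero_forcing sx).
by rewrite in_set => /mem_take.
Qed.
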